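(* Let $M,N$ be positive integers with $\gcd(M,N)=1$. Let $u\in\mathbb{C}^M$ be unimodular and satisfy $\langle\tau_{-k}u,u\rangle=0$ for every $k\in\mathbb{Z}/M\mathbb{Z}$ with $k\ne0$. Let $v\in\mathbb{C}^N$ be unimodular and let $\varphi\in\mathbb{C}^{MN}$ be $\varphi=u\otimes v$, where $\otimes$ is the Kronecker product. Let $\Lambda=\{0,N,\dots,(M-1)N\}\times\{0,M,\dots,(N-1)M\}\subseteq(\mathbb{Z}/MN\mathbb{Z})\times(\mathbb{Z}/MN\mathbb{Z})^{\widehat{}}$. Then $(\varphi,\Lambda)$ is a tight frame for $\mathbb{C}^{MN}$ with frame bound $MN$.
   Context: For a positive integer $D$, vectors in $\mathbb{C}^D$ are indexed by $\mathbb{Z}/D\mathbb{Z}$, and $\langle x,y\rangle=\sum_j x[j]\overline{y[j]}$. A vector is unimodular if all its entries have absolute value $1$. Translation and modulation on $\mathbb{C}^D$ are $\tau_k(\varphi)[j]=\varphi[j-k]$ and $e_\ell(\varphi)[j]=e^{2\pi i j\ell/D}\varphi[j]$. The character group $(\mathbb{Z}/D\mathbb{Z})^{\widehat{}}$ is identified with $\mathbb{Z}/D\mathbb{Z}$. For $\Lambda\subseteq(\mathbb{Z}/D\mathbb{Z})\times(\mathbb{Z}/D\mathbb{Z})^{\widehat{}}$, the Gabor system is the family $(\varphi,\Lambda)=\{e_\ell\tau_k\varphi:(k,\ell)\in\Lambda\}$, indexed by $\Lambda$ (first coordinate translation, second modulation). A finite family $\{v_i\}$ in $\mathbb{C}^D$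 is a tight frame with frame bound $A>0$ if $\sum_i|\langle x,v_i\rangle|^2=A\|x\|_2^2$ for all $x\in\mathbb{C}^D$. The Kronecker product $u\otimes v$ has entries $(u\otimes v)[rN+s]=u[r]v[s]$ for $0\le r\le M-1$, $0\le s\le N-1$. *)

(* Defs.v *)
(* Finite Gabor systems over the complex numbers R[i] of an arbitrary
   R : realType.  A vector of C^D is a column vector 'cV[R[i]]_D, and the
   residue classes mod D are represented by their representatives in 'I_D,
   including for D = 1, which 'Z_D would not allow. *)
From mathcomp Require Import all_boot all_order all_algebra.
From mathcomp Require Import reals trigo.
From mathcomp Require Export complex mxtens.

Set Implicit Arguments.
Unset Strict Implicit.
Unset Printing Implicit Defensive.

Import Order.TTheory GRing.Theory Num.Theory.
Local Open Scope ring_scope.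
Local Open Scope complex_scope.

Lemma ord_gt0 (D : nat) (j : 'I_D) : (0 < D)%N.
Proof. exact: leq_ltn_trans (leq0n j) (ltn_ord j). Qed.

(* Subtraction and opposite in Z/DZ; [k <= D] makes the truncated
   subtraction [D - k] exact. *)
Definition ord_sub (D : nat) (j k : 'I_D) : 'I_D :=
  Ordinal (ltn_pmod (j + (D - k)) (ord_gt0 j)).

Definition ord_opp (D : nat) (k : 'I_D) : 'I_D :=
  Ordinal (ltn_pmod (D - k) (ord_gt0 k)).

Section Gabor.
Variable R : realType.
Local Notation C := R[i].

Definition expi (t : R) : C := cos t +i* sin t.

Definition inner (D : nat) (x y : 'cV[C]_D) : C :=
  \sum_(j < D) x j 0 * Num.conj (y j 0).

Definition unimodular (D : nat) (x : 'cV[C]_D) : Prop :=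
  forall j : 'I_D, `|x j 0| = 1.

Definition translation (D : nat) (k : 'I_D) (f : 'cV[C]_D) : 'cV[C]_D :=
  \col_j f (ord_sub j k) 0.

Definition modulation (D : nat) (l : 'I_D) (f : 'cV[C]_D) : 'cV[C]_D :=
  \col_j (expi (2 * pi * j%:R * l%:R / D%:R) * f j 0).

(* A family indexed by L, not a set of vectors: repetitions count. *)
Definition gabor (D : nat) (f : 'cV[C]_D) (L : {set 'I_D * 'I_D})
    (p : {p : 'I_D * 'I_D | p \in L}) : 'cV[C]_D :=
  modulation (val p).2 (translation (val p).1 f).

Definition tight_frame (D : nat) (I : finType) (w : I -> 'cV[C]_D) (A : R)
    : Prop :=
  0 < A /\
  forall x : 'cV[C]_D,
    \sum_(i : I) `|inner x (w i)| ^+ 2 = A%:C * \sum_(j < D) `|x j 0| ^+ 2.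

End Gabor.

Arguments gabor {R D} f L p.

(* {0, a, ..., (m - 1) a} as a subset of Z/DZ, for m a <= D. *)
Definition multiples (D m a : nat) : {set 'I_D} :=
  [set k : 'I_D | [exists r : 'I_m, k == (r * a)%N :> nat]].

(* Main.v *)
(* Writing j = rN + s, the atom attached to (aN, bM) is the tensor product of
   the translate of u by a with the modulation of v by b.  The translates of u
   and the modulations of v are orthogonal bases of C^M and C^N; in terms of
   the columns of the analysis matrix this says that the sum over (a, b) of the
   products of two columns is MN on the diagonal and 0 off it, which is
   Parseval's identity with constant MN. *)
Require Import Defs.
From mathcomp Require Import all_boot all_order all_algebra.
From mathcomp Require Import reals.
From mathcomp Require Import trigo ring lra.

Import Order.TTheory GRing.Theory Num.Theory.
Local Open Scope complex_scope.
Local Open Scope ring_scope.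

(** Expanding each squared modulus gives a double sum over [j], [j']; summing over [i] first leaves
    products of two columns as coefficients, so only the diagonal survives. *)
Lemma parseval_of_orthogonal_columns (F : numClosedFieldType) (I J : finType)
    (E : I -> J -> F) (c : F) (x : J -> F) :
  (forall j j', \sum_i (E i j)^* * E i j' = c *+ (j == j')) ->
  \sum_i `|\sum_j x j * (E i j)^*| ^+ 2 = c * \sum_j `|x j| ^+ 2.
Proof.
move=> orthE.
transitivity (\sum_j \sum_j' x j * (x j')^* * \sum_i (E i j)^* * E i j').
  under eq_bigr => i _.
    rewrite normCK rmorph_sum mulr_suml.
    under eq_bigr => j _.
      rewrite mulr_sumr.
      under eq_bigr => j' _ do rewrite rmorphM /= conjCK mulrACA.
      over.
    over.
  rewrite exchange_big; apply: eq_bigr => j _.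
  by rewrite exchange_big; apply: eq_bigr => j' _; rewrite mulr_sumr.
rewrite mulr_sumr; apply: eq_bigr => j _.
under eq_bigr => j' _ do rewrite orthE mulrnAr mulrb.
rewrite -big_mkcond (big_pred1 j) => [|j']; last exact: eq_sym.
by rewrite -normCK mulrC.
Qed.

(** Since [z] has modulus 1, its conjugate is its inverse, and the sum is geometric with ratio [w],
    the quotient of [z ^+ t] by [z ^+ s]. Primitivity gives [w != 1] when [s != t]. *)
Lemma sum_prim_root_conj (F : numClosedFieldType) (N : nat) (z : F)
    (s t : 'I_N) :
  N.-primitive_root z ->
  \sum_(b < N) ((z ^+ (b * s))^* * z ^+ (b * t)) = N%:R *+ (s == t).
Proof.
move=> z_prim; have zN := prim_expr_order z_prim.
have nz : `|z| = 1.
  apply/eqP; rewrite -(@pexpr_eq1 _ _ N) ?normr_ge0 ?(prim_order_gt0 z_prim) //.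
  by rewrite -normrX zN normr1.
have z0 : z != 0 by rewrite -normr_eq0 nz oner_eq0.
have cz : z^* = z^-1 by rewrite invC_norm nz expr1n invr1 mul1r.
pose w := z ^- s * z ^+ t.
transitivity (\sum_(b < N) w ^+ b).
  apply: eq_bigr => b _.
  by rewrite rmorphXn /= cz exprMn !exprVn -!exprM mulnC (mulnC b t).
have [eq_st|ne_st] := eqVneq s t.
  rewrite /w eq_st mulVf ?expf_neq0 //; under eq_bigr do rewrite expr1n.
  by rewrite sumr_const card_ord.
have w1 : w - 1 != 0.
  apply: contraNneq ne_st => /eqP; rewrite subr_eq0 => /eqP w1.
  have /eqP : z ^+ s = z ^+ t by rewrite -[LHS]mulr1 -w1 mulVKf ?expf_neq0.
  by rewrite (eq_prim_root_expr z_prim) !modn_small // => /eqP/val_inj->.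
(* Multiplying by [w - 1] telescopes the sum to [w ^+ N - 1], which is 0. *)
apply: (mulfI w1); rewrite -subrX1 mulr0n mulr0 /w exprMn exprVn -!exprM.
by rewrite mulnC (mulnC t) !exprM zN !expr1n invr1 mulr1 subrr.
Qed.

Section Exp.
Variable R : realType.

Lemma expiD (x y : R) : expi (x + y) = expi x * expi y.
Proof.
by apply/eqP; rewrite eq_complex /= cosD sinD eqxx addrC [cos x * _]mulrC eqxx.
Qed.

Lemma expi0 : expi (0 : R) = 1.
Proof. by rewrite /expi cos0 sin0. Qed.

Lemma expiMn (x : R) n : expi (x *+ n) = expi x ^+ n.
Proof. by elim: n => [|n IHn]; rewrite ?expi0 // mulrS expiD IHn exprS. Qed.

(** The real part is 1 - 2 sin^2(x/2), and sin(x/2) > 0 because x/2 lies strictly between 0 and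
    pi. *)
Lemma expi_neq1 (x : R) : 0 < x < 2 * pi -> expi x != 1.
Proof.
move=> x_bd; rewrite eq_complex /= negb_and; apply/orP; left.
have sx : 0 < sin (x / 2) by apply: sin_gt0_pi; lra.
have -> : x = (x / 2) *+ 2 by field.
rewrite cos_mulr2n cos2sin2; apply: contraTneq sx => h.
have : sin (x / 2) ^+ 2 = 0 by lra.
by move/eqP; rewrite sqrf_eq0 => /eqP ->; rewrite ltxx.
Qed.

Lemma expi_prim_root N : (0 < N)%N ->
  N.-primitive_root (expi (2 * pi / N%:R) : R[i]).
Proof.
move=> N0; have NR0 : 0 < N%:R :> R by rewrite ltr0n.
apply/andP; split=> //; apply/forallP => i; rewrite unity_rootE -expiMn.
apply/eqP; have [->|ne_iN] := eqVneq i.+1 N.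
  have -> : 2 * pi / N%:R *+ N = pi *+ 2 :> R.
    by rewrite -[LHS]mulr_natr mulfVK ?gt_eqF // mulr_natl.
  rewrite /expi cos2pi sin2pi.
  exact: eqxx.
(* A power with exponent strictly between 0 and [N] has its angle strictly between 0 and 2 pi. *)
apply/negbTE/expi_neq1; have pi0 := pi_gt0 R.
have lt_iN : (i.+1 < N)%N by rewrite ltn_neqAle ne_iN ltn_ord.
rewrite -[_ *+ i.+1]mulr_natr -mulrA mulr_gt0 ?mulr_gt0 ?ltr0n ?invr_gt0 //=.
by rewrite gtr_pMr ?mulr_gt0 // mulrC ltr_pdivrMr // mul1r ltr_nat.
Qed.
End Exp.

Lemma sum_translates (R : realType) (M : nat) (u : 'cV[R[i]]_M) :
  unimodular u ->
  (forall k : 'I_M, k != 0%N :> nat ->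
     inner (translation (ord_opp k) u) u = 0) ->
  forall r r' : 'I_M,
    \sum_(a < M) ((u (ord_sub r a) 0)^* * u (ord_sub r' a) 0)
      = M%:R *+ (r == r').
Proof.
(* Writing [M] as [m.+1] gives ['I_M] its additive group structure; [M = 0] has no index [r]. *)
case: M u => [|m] u hu hu_orth r r'; first by case: r.
have subE (j k : 'I_m.+1) : ord_sub j k = j - k.
  by apply: val_inj; rewrite /= modnDmr.
have oppE (k : 'I_m.+1) : ord_opp k = - k by apply: val_inj.
transitivity (inner (translation (ord_opp (r' - r)) u) u).
  (* The substitution a = r - j turns u[r' - a] into u[j + (r' - r)], the entry at j of the
     translate by -(r' - r). *)
  rewrite /inner (reindex_inj (inv_inj (@subKr _ r))) /=.
  apply: eq_bigr => j _; rewrite mxE !subE oppE mulrC.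
  by rewrite subKr opprK opprB addrCA.
have [<-|ne_r] := eqVneq r r'; last first.
  apply: hu_orth; apply: contraNneq ne_r => r0.
  have /eqP : r' - r = 0 by apply: val_inj.
  by rewrite subr_eq0 eq_sym.
rewrite /inner subrr; transitivity (\sum_(j < m.+1) (1 : R[i])).
  apply: eq_bigr => j _; rewrite mxE subE oppE oppr0 subr0.
  by rewrite -normCK hu expr1n.
by rewrite sumr_const card_ord.
Qed.

Lemma big_multiples (D m a : nat) (V : nmodType) (F : 'I_D -> V)
    (lt_mD : forall r : 'I_m, (r * a < D)%N) : (0 < a)%N ->
  \sum_(k in multiples D m a) F k = \sum_(r < m) F (Ordinal (lt_mD r)).
Proof.
move=> a0.
have inj : injective (fun r => Ordinal (lt_mD r)).
  by move=> r r' /(congr1 val)/eqP; rewrite /= eqn_pmul2r // => /eqP/val_inj.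
rewrite -(big_imset _ (in2W inj)); apply: eq_bigl => k.
rewrite inE; apply/existsP/imsetP => [[r /eqP kE]|[r _ ->]]; exists r => //.
exact: val_inj.
Qed.

(** In (rN + s)bM / (MN) = bs/N + br the integer br is a whole number of turns, so the modulation
    depends on [s] only. *)
Lemma expi_modulation (R : realType) (M N b r s : nat) :
  (0 < M)%N -> (0 < N)%N ->
  expi (2 * pi * (r * N + s)%:R * (b * M)%:R / (M * N)%:R : R)
    = expi (2 * pi / N%:R) ^+ (b * s).
Proof.
move=> M0 N0.
have MR : M%:R != 0 :> R by rewrite pnatr_eq0 -lt0n.
have NR : N%:R != 0 :> R by rewrite pnatr_eq0 -lt0n.
have -> : 2 * pi * (r * N + s)%:R * (b * M)%:R / (M * N)%:R
    = 2 * pi / N%:R * (b * s)%:R + 2 * pi / N%:R * (N * (b * r))%:R :> R.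
  by rewrite !(natrD, natrM); field; rewrite NR MR.
rewrite expiD !mulr_natr !expiMn [X in _ * X]exprM.
by rewrite (prim_expr_order (expi_prim_root _ _ N0)) expr1n mulr1.
Qed.

Lemma ord_sub_mxtens_index (M N : nat) (r a : 'I_M) (s : 'I_N)
    (lt_aN : (a * N < M * N)%N) :
  ord_sub (mxtens_index (r, s)) (Ordinal lt_aN) = mxtens_index (ord_sub r a, s).
Proof.
apply: val_inj => /=; rewrite -mulnBl addnAC -mulnDl.
(* The quotient of r + (M - a) by M contributes a multiple of MN; the rest is the value of an index,
   hence already reduced. *)
rewrite {1}(divn_eq (r + (M - a)) M) mulnDl -addnA -mulnA modnMDl modn_small //.
exact: ltn_ord (mxtens_index (ord_sub r a, s)).
Qed.

Theorem proposition5p5 (R : realType) (M N : nat)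
    (hM : (0 < M)%N) (hN : (0 < N)%N) (hMN : coprime M N)
    (u : 'cV[R[i]]_M) (hu : unimodular u)
    (hu_orth : forall k : 'I_M, k != 0%N :> nat ->
       inner (translation (ord_opp k) u) u = 0%R)
    (v : 'cV[R[i]]_N) (hv : unimodular v) :
  tight_frame
    (gabor (tensmx u v : 'cV[R[i]]_(M * N))
       (setX (multiples (M * N) M N) (multiples (M * N) N M)))
    (M * N)%:R%R.
Proof.
split=> [|x]; first by rewrite ltr0n muln_gt0 hM.
have lt_aN (a : 'I_M) : (a * N < M * N)%N by rewrite ltn_pmul2r.
have lt_bM (b : 'I_N) : (b * M < M * N)%N by rewrite mulnC ltn_pmul2l.
rewrite rmorph_nat.
apply: parseval_of_orthogonal_columns => j j'.
(* [g] is defined on all pairs, so the sum over the subtype becomes one over a product set. *)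
pose g (p : 'I_(M * N) * 'I_(M * N)) i : R[i] :=
  modulation p.2 (translation p.1 (tensmx u v : 'cV_(M * N))) i 0.
transitivity (\sum_(p in setX (multiples (M * N) M N) (multiples (M * N) N M))
   ((g p j)^* * g p j')); first by rewrite [RHS]big_sub.
transitivity (\sum_(k in multiples (M * N) M N) 
   \sum_(l in multiples (M * N) N M) ((g (k, l) j)^* * g (k, l) j')).
  rewrite pair_big; apply: eq_big => [[k l]|[k l] _ //]; exact: in_setX.
rewrite (big_multiples _ _ _ _ _ lt_aN) //.
under eq_bigr do rewrite (big_multiples _ _ _ _ _ lt_bM) //.
pose z : R[i] := expi (2 * pi / N%:R).
have gE (a r : 'I_M) (b s : 'I_N) :
    g (Ordinal (lt_aN a), Ordinal (lt_bM b)) (mxtens_index (r, s))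
    = u (ord_sub r a) 0 * (z ^+ (b * s) * v s 0).
  rewrite /g !mxE expi_modulation // ord_sub_mxtens_index mxtens_indexK.
  by rewrite mulrCA; do 3?congr (_ * _); congr (_ _ _); exact: ord1.
case: (mxtens_indexP j) => r s; case: (mxtens_indexP j') => r' s'.
(* The factor from [v] does not depend on [a] or [b], so the double sum splits into a product. *)
transitivity ((\sum_(a < M) (u (ord_sub r a) 0)^* * u (ord_sub r' a) 0) *
    (\sum_(b < N) (z ^+ (b * s))^* * z ^+ (b * s')) * ((v s 0)^* * v s' 0)).
  rewrite -mulrA mulr_suml; apply: eq_bigr => a _.
  rewrite mulr_suml mulr_sumr; apply: eq_bigr => b _.
  by rewrite !gE !rmorphM; ring.
rewrite sum_translates // sum_prim_root_conj; last exact: expi_prim_root.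
rewrite (can_eq (@mxtens_indexK M N)) xpair_eqE.
have [_|_] := eqVneq r r'; last by rewrite mulr0n !mul0r.
have [<-|_] := eqVneq s s'; last by rewrite mulr0n mulr0 mul0r.
(* On the diagonal the factor from [v] is |v[s]|^2 = 1. *)
by rewrite [(v s 0)^* * _]mulrC -normCK hv expr1n mulr1 !mulr1n natrM.
Qed.
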